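(* There is a generic subset $\mathcal{G}$ of $\mathcal{S}^{II}_n$ such that, for every system $\sigma\in\mathcal{G}$, there is some $\widehat{\sigma}\in\mathcal{G}$ such that (1) $\sigma$ and $\widehat{\sigma}$ are i/o equivalent under every constant input, but (2) $\sigma$ and $\widehat{\sigma}$ are not i/o equivalent.
   Context: A 4-tuple of dimension $n$ is $(A,N,b,c)$ with $A,N\in\mathbb{R}^{n\times n}$, $b\in\mathbb{R}^{n\times 1}$, $c\in\mathbb{R}^{1\times n}$. The bilinear system of type II associated with it is $\dot x=(A+uN)x$, $x(0)=b$, $y=cx$. The class $\mathcal{S}^{II}_n$ of all $n$-dimensional bilinear systems of type II is identified with $\mathbb{R}^{2n^2+2n}$ via 4-tuples. A subset of $\mathbb{R}^\ell$ is called generic if it is open and dense and its complement has Lebesgue measure zero. Inputs are Lebesgue-measurable, essentially bounded functions $u:[0,T_u]\to\mathbb{R}$; $\Omega$ is the set of all inputs. Two systems are i/o equivalent under a set $\mathcal{U}\subseteq\Omega$ of inputs if for each $u\in\mathcal{U}$ the two outputs $y(t)$ coincide for all $t\in[0,T_u]$; they are i/o equivalent (no qualifier) if this holds with $\mathcal{U}=\Omega$. Constant inputs are $u\equiv\beta$, $\beta\in\mathbb{R}$ arbitrary.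
   Formalization: The dimension n is assumed to be at least 2; for n = 0 and n = 1 the claim is false, since there two systems that are i/o equivalent under every constant input are always i/o equivalent. *)

(* Defs.v *)
From HB Require Import structures.
From mathcomp Require Import all_boot all_order all_algebra.
From mathcomp Require Import all_classical all_reals all_analysis.
Import Order.TTheory GRing.Theory Num.Theory.
Import numFieldNormedType.Exports.

Set Implicit Arguments.
Unset Strict Implicit.
Unset Printing Implicit Defensive.

Local Open Scope classical_set_scope.
Local Open Scope ring_scope.

Section generic.
Context {R : realType} {l : nat}.
Implicit Types (a b : 'rV[R]_l) (S G : set 'rV[R]_l).

Definition box a b : set 'rV[R]_l :=
  [set x | forall i, a ord0 i <= x ord0 i <= b ord0 i].

Definition box_volume a b : R := \prod_(i < l) (b ord0 i - a ord0 i).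

(* Lebesgue outer measure on R^l: the infimum of the total volumes of the
   countable covers by boxes. The predicate D selects the boxes actually used,
   so that finite and empty covers are allowed also when l = 0. A set is
   Lebesgue measurable of measure zero iff its outer measure is zero. *)
Definition lebesgue_outer_measure S : \bar R :=
  ereal_inf [set v | exists (D : pred nat) (a b : nat -> 'rV[R]_l),
    [/\ forall k i, a k ord0 i <= b k ord0 i,
        S `<=` \bigcup_(k in [set k | D k]) box (a k) (b k) &
        v = (\sum_(0 <= k <oo | D k) (box_volume (a k) (b k))%:E)%E]].

Definition generic G : Prop :=
  [/\ open G, dense G & lebesgue_outer_measure (~` G) = 0%E].

End generic.

Record bilinear_system (R : realType) (n : nat) := BilinearSystem {
  sysA : 'M[R]_n;
  sysN : 'M[R]_n;
  sysb : 'cV[R]_n;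
  sysc : 'rV[R]_n }.

(* The identification of the 4-tuples with R^(2n^2 + 2n). *)
Definition system_vec (R : realType) (n : nat) (sigma : bilinear_system R n) :
    'rV[R]_((n * n + n * n) + (n + n)) :=
  row_mx (row_mx (mxvec (sysA sigma)) (mxvec (sysN sigma)))
         (row_mx (sysb sigma)^T (sysc sigma)).

Definition generic_systems (R : realType) (n : nat)
    (G : set (bilinear_system R n)) : Prop :=
  generic (@system_vec R n @` G).

(* The domain type of [completed_lebesgue_measure] is R with the sigma-algebra
   of Lebesgue (as opposed to Borel) measurable sets. *)
Notation lebesgueType R :=
  (caratheodory_type (R := R) (mu_ext (wlength (R := R) idfun))).

(* An input u : [0, T_u] -> R is represented by a function on the whole line,
   of which only the restriction to [0, T_u] is ever used. *)
Record input (R : realType) := Input {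
  duration : R;
  signal : R -> R;
  duration_ge0 : 0 <= duration;
  signal_measurable :
    measurable_fun (`[0, duration]%classic : set (lebesgueType R))
      (signal : lebesgueType R -> R);
  signal_ess_bounded : exists M : R,
    {ae @completed_lebesgue_measure R,
      forall t : R, t \in `[0, duration] -> `|signal t| <= M} }.

Section io.
Context {R : realType} {n : nat}.
Implicit Types (sigma : bilinear_system R n) (u : input R).

(* x is a (Caratheodory) solution on [0, T_u] of x' = (A + u N) x, x(0) = b,
   i.e. x(t) = b + int_0^t (A + u(s) N) x(s) ds. *)
Definition is_trajectory sigma u (x : R -> 'cV[R]_n) : Prop :=
  {within `[0, duration u], continuous x} /\
  forall t : R, t \in `[0, duration u] -> forall i : 'I_n,
    x t i ord0 = sysb sigma i ord0 +
      \int[@completed_lebesgue_measure R]_(s in `[0, t])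
        (((sysA sigma + signal u s *: sysN sigma) *m x s) i ord0).

Definition is_output sigma u (y : R -> R) : Prop :=
  exists2 x, is_trajectory sigma u x &
    forall t : R, t \in `[0, duration u] -> y t = (sysc sigma *m x t) ord0 ord0.

(* A linear equation with essentially bounded coefficients has exactly one
   solution on [0, T_u], so y and y' below range over exactly one function
   each, up to their values outside [0, T_u]. *)
Definition io_equivalent_under (U : set (input R)) sigma sigma' : Prop :=
  forall u, U u -> forall y y' : R -> R,
    is_output sigma u y -> is_output sigma' u y' ->
    forall t : R, t \in `[0, duration u] -> y t = y' t.

Definition io_equivalent sigma sigma' : Prop :=
  io_equivalent_under setT sigma sigma'.

End io.

Definition constant_inputs (R : realType) : set (input R) :=
  [set u | exists beta : R,
    forall t : R, t \in `[0, duration u] -> signal u t = beta].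

(* Main.v *)
Require Import Defs.
From HB Require Import structures.
From mathcomp Require Import all_boot all_order all_algebra.
From mathcomp Require Import all_classical all_reals all_analysis.
Import Order.TTheory GRing.Theory Num.Theory.
Import numFieldNormedType.Exports.
From mathcomp Require Import measurable_realfun ring lra.
Local Open Scope classical_set_scope.
Local Open Scope ring_scope.

Set Implicit Arguments.
Unset Strict Implicit.
Unset Printing Implicit Defensive.

(** Under a constant input beta the output of (A, N, b, c) is
    c e^(t(A + beta N)) b. A number is its own transpose, so the dual system
    (A^T, N^T, c^T, b^T) has the same output. Under an input that switches,
    the order of the factors starts to matter: with P = A and Q = A + N, the
    input that is 0 on [0, s] and 1 on ]s, s + r] produces at time s + r the
    value c e^(rQ) e^(sP) b for the system and c e^(sP) e^(rQ) b for its dual.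
    If these agreed for all nonnegative s and r, then differentiating on the
    right at r = 0 and at s = 0 would give c Q P b = c P Q b, that is
    c (AN - NA) b = 0 ([dual_io_equivalent_commute]). So the systems with
    c (AN - NA) b <> 0 form the required set; duality changes the sign of
    this number and hence preserves the set.

    This set is generic ([generic_commutator]) because c (AN - NA) b is affine
    in each coordinate separately. Differentiating along one well chosen
    coordinate at a time leads from c (AN - NA) b, through one entry of
    (AN - NA) b, one entry of AN - NA and one entry of N, to the constant 1,
    and [generic_neq0_of_slope] climbs back: where the slope of a function
    along a coordinate is nonzero, the zero set of the function is locally a
    Lipschitz graph over the other coordinates, hence null.

    On the analytic side, the matrix exponential is defined entrywise by its
    power series. For constant inputs every trajectory is shown to be the
    exponential one ([constant_input_trajectory]); for switched inputs it is
    enough to exhibit a trajectory ([switch_output]). *)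

(** * Null sets for the box outer measure *)

Section outer_measure.
Context {R : realType} {l : nat}.
Implicit Types (S : set 'rV[R]_l).

Lemma box_volume_ge0 (a b : 'rV[R]_l) :
  (forall j, a ord0 j <= b ord0 j) -> 0 <= box_volume a b.
Proof. by move=> ab; apply: prodr_ge0 => j _; rewrite subr_ge0. Qed.

Lemma lebesgue_outer_measure_ge0 S : (0 <= lebesgue_outer_measure S)%E.
Proof.
apply: le_ereal_inf_tmp => _ [D [a [b [ab _ ->]]]].
by apply: nneseries_ge0 => k _ _; rewrite lee_fin box_volume_ge0.
Qed.

(** Covers may be indexed by any countable type, which gives at once finite
    covers and covers of countable unions, indexed by pairs. *)
Lemma lebesgue_outer_measure_le_esum (I : countType) (D : pred I)
    (a b : I -> 'rV[R]_l) S :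
  (forall i j, a i ord0 j <= b i ord0 j) ->
  S `<=` \bigcup_(i in [set i | D i]) box (a i) (b i) ->
  (lebesgue_outer_measure S <=
    \esum_(i in [set i | D i]) (box_volume (a i) (b i))%:E)%E.
Proof.
move=> ab SD; apply: ereal_inf_lbound.
pose E k := oapp D false (pickle_inv k).
pose a' k := oapp a 0 (pickle_inv k); pose b' k := oapp b 0 (pickle_inv k).
have ab' k j : a' k ord0 j <= b' k ord0 j.
  by rewrite /a' /b'; case: pickle_inv => //=.
exists E, a', b'; split => //.
- move=> x /SD[i Di xi]; exists (pickle i) => /=.
    by rewrite /E pickleK_inv.
  by rewrite /a' /b' pickleK_inv.
- rewrite nneseries_esum; last by move=> k _; rewrite lee_fin box_volume_ge0.
  rewrite (@reindex_esum R I nat [set i | D i] [set k | E k] pickle).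
    by apply: eq_esum => i _ /=; rewrite /a' /b' pickleK_inv.
  split.
  + by move=> i /= Di; rewrite /E pickleK_inv.
  + by move=> i j _ _ /(congr1 (@pickle_inv I)); rewrite !pickleK_inv => -[].
  + move=> k /=; rewrite /E; case Ek: (pickle_inv k) => [i|//] /= Di.
    by exists i => //; have := pickle_invK (T := I) k; rewrite Ek.
Qed.

Lemma lebesgue_outer_measure_eq0_lt S (e : R) :
  lebesgue_outer_measure S = 0%E -> 0 < e ->
  exists (D : pred nat) (a b : nat -> 'rV[R]_l),
    [/\ forall k j, a k ord0 j <= b k ord0 j,
        S `<=` \bigcup_(k in [set k | D k]) box (a k) (b k) &
        (\esum_(k in [set k | D k]) (box_volume (a k) (b k))%:E <= e%:E)%E].
Proof.
move=> S0 e0.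
move: S0; rewrite /lebesgue_outer_measure; set V := [set v | _] => V0.
have /(lb_ereal_inf_adherent e0)[v [D [a [b [ab SD vE]]]] ve] :
  ereal_inf V \is a fin_num by rewrite V0.
exists D, a, b; split => //.
rewrite -nneseries_esum; last by move=> k _; rewrite lee_fin box_volume_ge0.
by rewrite -vE; apply/ltW; move: ve; rewrite V0 add0e.
Qed.

Lemma lebesgue_outer_measure_eq0 S :
  (forall e : R, 0 < e -> (lebesgue_outer_measure S <= e%:E)%E) ->
  lebesgue_outer_measure S = 0%E.
Proof.
move=> Se; apply/eqP; rewrite eq_le lebesgue_outer_measure_ge0 andbT.
by apply/lee_addgt0Pr => e /Se; rewrite add0e.
Qed.

Lemma lebesgue_outer_measure_subset S T : S `<=` T ->
  lebesgue_outer_measure T = 0%E -> lebesgue_outer_measure S = 0%E.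
Proof.
move=> ST T0; apply: lebesgue_outer_measure_eq0 => e e0.
have [D [a [b [ab TD vD]]]] := lebesgue_outer_measure_eq0_lt T0 e0.
apply: (le_trans _ vD); apply: lebesgue_outer_measure_le_esum => //.
exact: subset_trans ST TD.
Qed.

Lemma lebesgue_outer_measure_bigcup0 (F : nat -> set 'rV[R]_l) :
  (forall k, lebesgue_outer_measure (F k) = 0%E) ->
  lebesgue_outer_measure (\bigcup_k F k) = 0%E.
Proof.
move=> F0; apply: lebesgue_outer_measure_eq0 => e e0.
have e0k k : 0 < e / (2 ^ k.+1)%:R by rewrite divr_gt0// ltr0n expn_gt0.
have /choice[D] := fun k => lebesgue_outer_measure_eq0_lt (F0 k) (e0k k).
move=> /choice[a] /choice[b] Dab.
have ab k i j : a k i ord0 j <= b k i ord0 j by case: (Dab k).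
apply: (@le_trans _ _ (\esum_(i in [set i | D i.1 i.2])
    (box_volume (a i.1 i.2) (b i.1 i.2))%:E)%E).
  apply: (@lebesgue_outer_measure_le_esum _ (fun i => D i.1 i.2)
    (fun i => a i.1 i.2) (fun i => b i.1 i.2)) => //.
  move=> x [k _]; case: (Dab k) => _ + _ => /[apply] -[i /= Di xi].
  by exists (k, i).
have -> : [set i | D i.1 i.2] =
    ([set: nat] `*`` (fun k => [set i | D k i])).
  by apply/seteqP; split => [[i j]|[i j] []].
rewrite -(@esum_esum _ _ _ setT (fun k => [set i | D k i])
    (fun k i => (box_volume (a k i) (b k i))%:E)); last first.
  by move=> i j _ _; rewrite lee_fin box_volume_ge0.
apply: (le_trans _ (epsilon_trick0 xpredT (ltW e0))).
rewrite nneseries_esumT; last by move=> n; rewrite lee_fin ltW.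
by apply: le_esum => k _; case: (Dab k).
Qed.

Lemma lebesgue_outer_measureU0 S T :
  lebesgue_outer_measure S = 0%E -> lebesgue_outer_measure T = 0%E ->
  lebesgue_outer_measure (S `|` T) = 0%E.
Proof.
move=> S0 T0; rewrite -bigcup2E; apply: lebesgue_outer_measure_bigcup0.
move=> [|[|k]] //=; apply: (lebesgue_outer_measure_subset _ S0).
exact: sub0set.
Qed.

Lemma lebesgue_outer_measure_finite_cover (I : finType)
    (a b : I -> 'rV[R]_l) S :
  (forall i j, a i ord0 j <= b i ord0 j) ->
  (forall x, S x -> exists i, box (a i) (b i) x) ->
  (lebesgue_outer_measure S <= (\sum_i box_volume (a i) (b i))%:E)%E.
Proof.
move=> ab SI.
apply: (le_trans (@lebesgue_outer_measure_le_esum _ xpredT a b _ ab _)).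
  by move=> x /SI[i xi]; exists i.
rewrite esum_fset//=; last by move=> i _; rewrite lee_fin box_volume_ge0.
rewrite -sumEFin -big_enum/= [leRHS]fsbig_seq ?enum_uniq//.
rewrite (_ : [set i | true] = [set` enum I])//.
by apply/seteqP; split => i //=; rewrite mem_enum.
Qed.

End outer_measure.

Lemma mesh_cell (R : realType) (M : nat) (d z : R) : 0 <= d ->
  0 <= z <= M.+1%:R * d ->
  exists k : 'I_M.+1, k%:R * d <= z <= k.+1%:R * d.
Proof.
move=> d0; elim: M => [|M IH] /andP[z0 zM].
  by exists ord0; rewrite mul0r z0.
have [/(conj z0)/andP/IH[k hk]|/ltW Mz] := leP z (M.+1%:R * d).
  by exists (widen_ord (leqnSn _) k).
by exists ord_max; rewrite Mz.
Qed.

(** A bounded piece S of a Lipschitz graph over the coordinates other than i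
    is null: cut those coordinates into m intervals of length d = 2K/m each.
    Over each of the m^(l-1) cells of the resulting grid, S lies in a slab of
    height 2Cd around any of its points, so S is covered by volume
    m^(l-1) d^(l-1) 2Cd, which is proportional to 1/m. *)
Lemma lipschitz_graph_null (R : realType) (l : nat) (i : 'I_l) (K C : R)
    (S : set 'rV[R]_l) :
  0 <= C -> 0 < K ->
  (forall x j, S x -> `|x ord0 j| <= K) ->
  (forall x y d, S x -> S y -> 0 <= d ->
    (forall j, j != i -> `|x ord0 j - y ord0 j| <= d) ->
    `|x ord0 i - y ord0 i| <= C * d) ->
  lebesgue_outer_measure S = 0%E.
Proof.
move=> C0 K0; case: l i S => [[//]|l] i S SK SC.
apply: lebesgue_outer_measure_eq0 => e e0.
pose V := (K *+ 2) ^+ l * (C *+ 2 * (K *+ 2)).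
have V0 : 0 <= V.
  by rewrite mulr_ge0// ?exprn_ge0// ?mulr_ge0// ?mulrn_wge0// ltW.
pose M := Num.bound (V / e); pose d := K *+ 2 / M.+1%:R.
have M0 : 0 < M.+1%:R :> R by rewrite ltr0n.
have d0 : 0 <= d by rewrite divr_ge0 ?mulrn_wge0// ltW.
have Md : M.+1%:R * d = K *+ 2 by rewrite mulrC divfK// gt_eqF.
pose lo (f : {ffun 'I_l -> 'I_M.+1}) j := (f j)%:R * d - K.
pose column f (y : 'rV[R]_l.+1) :=
  forall j, lo f j <= y ord0 (lift i j) <= lo f j + d.
(* a point of S over the cell f; a cell that S misses gets a useless slab *)
pose p f := xget 0 [set y | S y /\ column f y].
pose a f : 'rV[R]_l.+1 :=
  \row_j oapp (lo f) (p f ord0 i - C * d) (unlift i j).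
pose b f : 'rV[R]_l.+1 :=
  \row_j oapp (fun k => lo f k + d) (p f ord0 i + C * d) (unlift i j).
have ab f j : a f ord0 j <= b f ord0 j.
  rewrite !mxE; case: unliftP => [k|] _ /=; first by rewrite lerDl.
  by rewrite lerD2l ge0_cp// mulr_ge0.
have vol f : box_volume (a f) (b f) = (C *+ 2 * d) * d ^+ l.
  rewrite /box_volume (bigD1_ord i)//= !mxE unlift_none /=; congr (_ * _).
    by rewrite mulr2n; ring.
  rewrite (eq_bigr (fun=> d)); first by rewrite prodr_const card_ord.
  by move=> k _; rewrite !mxE liftK /= addrAC subrr add0r.
apply: (le_trans (lebesgue_outer_measure_finite_cover (a := a) (b := b) ab _)).
  move=> x Sx.
  have /choice[f Hf] : forall j : 'I_l, exists k : 'I_M.+1,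
      k%:R * d <= x ord0 (lift i j) + K <= k.+1%:R * d.
    move=> j; apply: mesh_cell => //.
    have := SK _ (lift i j) Sx; rewrite ler_norml Md => /andP[h1 h2].
    by apply/andP; split; lra.
  exists [ffun j => f j].
  have colx : column [ffun j => f j] x.
    move=> j; rewrite /lo ffunE; have /andP[h1 h2] := Hf j.
    rewrite -natr1 mulrDl mul1r in h2.
    by apply/andP; split; lra.
  have [Sp colp] : [set y | S y /\ column [ffun j => f j] y]
      (p [ffun j => f j]).
    by apply: xgetPex; exists x.
  move=> j; rewrite !mxE; case: unliftP => [k ->|->] /=; first exact: colx.
  have : `|x ord0 i - p [ffun j => f j] ord0 i| <= C * d.
    apply: SC => // k ki; have [k' ->|] := unliftP i k; last first.
      by move=> kE; rewrite kE eqxx in ki.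
    have /andP[h1 h2] := colx k'; have /andP[h3 h4] := colp k'.
    by rewrite ler_norml; apply/andP; split; lra.
  by rewrite ler_norml => /andP[h1 h2]; apply/andP; split; lra.
rewrite lee_fin (eq_bigr (fun=> (C *+ 2 * d) * d ^+ l)); last by move=> f _.
rewrite sumr_const card_ffun !card_ord -mulr_natr natrX.
rewrite (_ : _ * _ = V / M.+1%:R); last first.
  rewrite /V -Md; move: M.+1%:R d M0 {d0 Md lo column p a b ab vol} => m d m0.
  by rewrite exprMn; field; rewrite gt_eqF.
rewrite ler_pdivrMr// mulrC -ler_pdivrMr//.
apply/ltW/(lt_le_trans (archi_boundP _)); first by rewrite divr_ge0// ltW.
by rewrite ler_nat /M.
Qed.

(** * Functions that are generically nonzero *)

Section loc_lipschitz.
Context {R : realType} {l : nat}.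
Implicit Types (p q : 'rV[R]_l -> R).

(** The class of functions used for polynomials in the coordinates: it is
    stable under sums and products, and gives both continuity and the Lipschitz
    constants that the covering argument needs. *)
Definition loc_lipschitz p := forall K : R, 0 <= K -> exists2 L : R, 0 <= L &
  forall (x y : 'rV[R]_l) (d : R),
    (forall j, `|x ord0 j| <= K) -> (forall j, `|y ord0 j| <= K) ->
    0 <= d -> (forall j, `|x ord0 j - y ord0 j| <= d) -> `|p x - p y| <= L * d.

Lemma coord_le_norm (x : 'rV[R]_l) j : `|x ord0 j| <= `|x|.
Proof.
rewrite [leRHS]/Num.Def.normr/= mx_normrE.
by apply/bigmax_geP; right; exists (ord0, j).
Qed.

Lemma loc_lipschitz_cst (c : R) : loc_lipschitz (fun=> c).
Proof.
by move=> K _; exists 0 => // x y d _ _ _ _; rewrite subrr normr0 mul0r.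
Qed.

Lemma loc_lipschitz_coord j : loc_lipschitz (fun x => x ord0 j).
Proof. by move=> K _; exists 1 => // x y d _ _ _ xy; rewrite mul1r. Qed.

Lemma loc_lipschitzD p q : loc_lipschitz p -> loc_lipschitz q ->
  loc_lipschitz (fun x => p x + q x).
Proof.
move=> lp lq K K0; have [L L0 HL] := lp K K0; have [M M0 HM] := lq K K0.
exists (L + M); first exact: addr_ge0.
move=> x y d xK yK d0 xy; rewrite opprD addrACA mulrDl.
by apply: (le_trans (ler_normD _ _)); apply: lerD; [exact: HL|exact: HM].
Qed.

Lemma loc_lipschitzN p : loc_lipschitz p -> loc_lipschitz (fun x => - p x).
Proof.
move=> lp K K0; have [L L0 HL] := lp K K0; exists L => // x y d xK yK d0 xy.
by rewrite -opprD normrN; exact: HL.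
Qed.

Lemma loc_lipschitz_bounded p K : loc_lipschitz p -> 0 <= K ->
  exists2 B : R, 0 <= B &
    forall x : 'rV[R]_l, (forall j, `|x ord0 j| <= K) -> `|p x| <= B.
Proof.
move=> lp K0; have [L L0 HL] := lp K K0; exists (`|p 0| + L * K).
  by rewrite addr_ge0// mulr_ge0.
move=> x xK; rewrite -[p x](subrK (p 0)) addrC.
apply: (le_trans (ler_normD _ _)); rewrite lerD2l.
by apply: HL => // j; rewrite mxE ?normr0// subr0.
Qed.

Lemma loc_lipschitzM p q : loc_lipschitz p -> loc_lipschitz q ->
  loc_lipschitz (fun x => p x * q x).
Proof.
move=> lp lq K K0.
have [L L0 HL] := lp K K0; have [M M0 HM] := lq K K0.
have [A A0 HA] := loc_lipschitz_bounded lp K0.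
have [B B0 HB] := loc_lipschitz_bounded lq K0.
exists (A * M + L * B); first by rewrite addr_ge0// mulr_ge0.
move=> x y d xK yK d0 xy.
have -> : p x * q x - p y * q y = p x * (q x - q y) + (p x - p y) * q y.
  by ring.
apply: (le_trans (ler_normD _ _)); rewrite !normrM mulrDl.
rewrite -[A * M * d]mulrA [L * B * d]mulrAC; apply: lerD.
  by apply: ler_pM => //; [exact: HA|exact: HM].
by apply: ler_pM => //; [exact: HL|exact: HB].
Qed.

Lemma loc_lipschitz_sum (I : finType) (F : I -> 'rV[R]_l -> R) :
  (forall k, loc_lipschitz (F k)) -> loc_lipschitz (fun x => \sum_k F k x).
Proof.
move=> lF; have /(_ (index_enum I)) :
    forall s : seq I, loc_lipschitz (fun x => \sum_(k <- s) F k x).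
  elim=> [|k s IH].
    under eq_fun do rewrite big_nil.
    exact: loc_lipschitz_cst.
  under eq_fun do rewrite big_cons.
  exact: loc_lipschitzD.
by [].
Qed.

Lemma loc_lipschitz_mulmx m n k (F : 'rV[R]_l -> 'M[R]_(m, n))
    (G : 'rV[R]_l -> 'M[R]_(n, k)) :
  (forall i j, loc_lipschitz (fun x => F x i j)) ->
  (forall i j, loc_lipschitz (fun x => G x i j)) ->
  forall i j, loc_lipschitz (fun x => (F x *m G x) i j).
Proof.
move=> lF lG i j; under eq_fun do rewrite mxE.
by apply: loc_lipschitz_sum => h; exact: loc_lipschitzM.
Qed.

Lemma loc_lipschitz_continuous p : loc_lipschitz p -> continuous p.
Proof.
move=> lp x A /nbhs_ballP[e /= e0 eA].
have [L L0 HL] := lp (`|x| + 1) (addr_ge0 (normr_ge0 x) ler01).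
have xj j : `|x ord0 j| <= `|x|.
  exact: coord_le_norm.
pose d := Num.min 1 (e / (L + 1)).
have L1 : 0 < L + 1 by rewrite ltr_wpDl.
have d0 : 0 < d by rewrite lt_min ltr01 divr_gt0.
apply/nbhs_ballP; exists d => //= y [_ xy].
have {}xy j : `|x ord0 j - y ord0 j| < d by apply: xy.
apply: eA; rewrite /ball/=; apply: (@le_lt_trans _ _ (L * d)).
  apply: HL => //; last 2 first.
  - exact: ltW.
  - by move=> j; rewrite ltW.
  - by move=> j; rewrite (le_trans (xj j))// lerDl.
  - move=> j; rewrite -[y _ _](subKr (x ord0 j)).
    apply: (le_trans (ler_normB _ _)); apply: lerD => //.
    by rewrite (le_trans (ltW (xy j)))// ge_min lexx.
apply: (@lt_le_trans _ _ ((L + 1) * d)); first by rewrite ltr_pM2r// ltrDl.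
by rewrite mulrC -ler_pdivlMr// ge_min lexx orbT.
Qed.

(** Here q is the slope of p along the coordinate i. Moving along i away from
    a point where q <> 0 makes p nonzero, whence density. The zeros of p are
    among those of q and the sets E k below, where the size of the point and
    1/|q| are bounded: if x and y in E k are d-close outside i, sliding x
    along i to the height of y changes p by at most L d, and by at least
    |x_i - y_i| / (k + 1); so E k is a Lipschitz graph. *)
Lemma generic_neq0_of_slope (i : 'I_l) p q : loc_lipschitz p ->
  (forall x t, p (x + t *: delta_mx ord0 i) = p x + t * q x) ->
  generic [set x | q x != 0] -> generic [set x | p x != 0].
Proof.
move=> lp pq [_ dq q0]; split.
- have -> : [set x | p x != 0] = p @^-1` [set~ 0].
    by apply/seteqP; split => x /= /eqP.
  apply: open_comp; first by move=> x _; exact: loc_lipschitz_continuous.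
  exact/closed_openC/closed_eq.
- move=> O O0 oO; have [x [Ox /= qx]] := dq _ O0 oO.
  have [px|px] := eqVneq (p x) 0; last by exists x.
  have /nbhs_ballP[e /= e0 xO] := open_nbhs_nbhs (conj oO Ox).
  exists (x + (e / 2) *: delta_mx ord0 i); split => /=.
    apply: xO; split => // k j; rewrite !mxE /ball/= opprD addrA subrr sub0r.
    rewrite normrN normrM ger0_norm ?divr_ge0 ?(ltW e0)//.
    rewrite (@le_lt_trans _ _ (e / 2))//; last lra.
    rewrite ler_piMr ?divr_ge0 ?(ltW e0)//.
    by case: (_ && _); rewrite ?normr1 ?normr0.
  by rewrite pq px add0r mulf_neq0// gt_eqF// divr_gt0.
- pose E k := [set x : 'rV[R]_l | [/\ forall j, `|x ord0 j| <= k.+1%:R,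
    p x = 0 & 1 <= k.+1%:R * `|q x|]].
  apply: (@lebesgue_outer_measure_subset _ _ _
      ((~` [set x | q x != 0]) `|` \bigcup_k E k)); last first.
    apply: lebesgue_outer_measureU0 => //.
    apply: lebesgue_outer_measure_bigcup0 => k.
    have [L L0 HL] := lp k.+1%:R (ler0n R k.+1).
    apply: (@lipschitz_graph_null _ _ i k.+1%:R (k.+1%:R * L)) => //.
    + by rewrite mulr_ge0.
    + by move=> x j [].
    + move=> x y d [xk px qx] [yk py qy] d0 xy.
      pose t := y ord0 i - x ord0 i; pose z := x + t *: delta_mx ord0 i.
      have zi : z ord0 i = y ord0 i by rewrite !mxE !eqxx mulr1 addrC subrK.
      have zj j : j != i -> z ord0 j = x ord0 j.
        by move=> ji; rewrite !mxE (negbTE ji) andbF mulr0 addr0.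
      have : `|p z - p y| <= L * d.
        apply: HL => // j; have [->|ji] := eqVneq j i.
        - by rewrite zi.
        - by rewrite zj.
        - by rewrite zi subrr normr0.
        - by rewrite zj// xy.
      rewrite pq px py add0r subr0 normrM => tL.
      rewrite -[x ord0 i - _]opprB normrN -/t.
      apply: (@le_trans _ _ (k.+1%:R * (`|t| * `|q x|))); last first.
        by rewrite -mulrA ler_wpM2l.
      by rewrite mulrCA ler_peMr.
  move=> x /= /negP; rewrite negbK => /eqP px.
  have [qx|qx] := eqVneq (q x) 0; [by left|right].
  pose r := `|x| + `|q x|^-1.
  have r0 : 0 <= r by rewrite addr_ge0// invr_ge0.
  have rk : r <= (Num.bound r).+1%:R.
    by apply/ltW/(lt_le_trans (archi_boundP r0)); rewrite ler_nat.
  exists (Num.bound r) => //; split => //.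
    move=> j; apply: le_trans rk; rewrite ler_wpDr ?invr_ge0//.
    exact: coord_le_norm.
  rewrite -ler_pdivrMr ?normr_gt0// div1r; apply: le_trans rk.
  by rewrite ler_wpDl.
Qed.

Lemma generic_neq0_cst (c : R) : c != 0 ->
  generic [set x : 'rV[R]_l | c != 0].
Proof.
move=> c0; have -> : [set x : 'rV[R]_l | c != 0] = setT.
  by apply/seteqP; split.
split; first exact: openT.
  by move=> O O0 _; rewrite setIT.
rewrite setCT; apply: lebesgue_outer_measure_eq0 => e e0.
apply: (le_trans (@lebesgue_outer_measure_finite_cover _ _ void
  (fun=> 0) (fun=> 0) _ _ _)) => //.
by rewrite big_pred0 ?lee_fin ?ltW// => -[].
Qed.

End loc_lipschitz.

(** * The form c (AN - NA) b is generically nonzero *)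

Section commutator_form.
Context {R : realType} {n : nat}.
Local Notation V := 'rV[R]_((n * n + n * n) + (n + n)).
Implicit Types (v w : V) (sigma : bilinear_system R n).

Definition vecA v : 'M[R]_n := vec_mx (lsubmx (lsubmx v)).
Definition vecN v : 'M[R]_n := vec_mx (rsubmx (lsubmx v)).
Definition vecb v : 'cV[R]_n := (lsubmx (rsubmx v))^T.
Definition vecc v : 'rV[R]_n := rsubmx (rsubmx v).

Lemma system_vecK v :
  system_vec (BilinearSystem (vecA v) (vecN v) (vecb v) (vecc v)) = v.
Proof.
by rewrite /system_vec/= /vecA /vecN /vecb /vecc !vec_mxK trmxK !hsubmxK.
Qed.

Lemma vec_systemK sigma :
  [/\ vecA (system_vec sigma) = sysA sigma,
      vecN (system_vec sigma) = sysN sigma,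
      vecb (system_vec sigma) = sysb sigma &
      vecc (system_vec sigma) = sysc sigma].
Proof.
rewrite /system_vec /vecA /vecN /vecb /vecc.
by rewrite !(row_mxKl, row_mxKr) !mxvecK trmxK.
Qed.

Lemma lsubmx_delta m p q (i : 'I_m) (j : 'I_p) :
  lsubmx (delta_mx i (lshift q j) : 'M[R]_(m, p + q)) = delta_mx i j.
Proof. by apply/matrixP => a b; rewrite !mxE eq_lshift. Qed.

Lemma rsubmx_delta m p q (i : 'I_m) (j : 'I_q) :
  rsubmx (delta_mx i (rshift p j) : 'M[R]_(m, p + q)) = delta_mx i j.
Proof. by apply/matrixP => a b; rewrite !mxE eq_rshift. Qed.

Lemma lsubmx_delta0 m p q (i : 'I_m) (j : 'I_q) :
  lsubmx (delta_mx i (rshift p j) : 'M[R]_(m, p + q)) = 0.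
Proof. by apply/matrixP => a b; rewrite !mxE eq_lrshift andbF. Qed.

Lemma rsubmx_delta0 m p q (i : 'I_m) (j : 'I_p) :
  rsubmx (delta_mx i (lshift q j) : 'M[R]_(m, p + q)) = 0.
Proof. by apply/matrixP => a b; rewrite !mxE eq_rlshift andbF. Qed.

Definition submx_deltaE :=
  (lsubmx_delta, rsubmx_delta, lsubmx_delta0, rsubmx_delta0).

Lemma vecP v w t :
  [/\ vecA (v + t *: w) = vecA v + t *: vecA w,
      vecN (v + t *: w) = vecN v + t *: vecN w,
      vecb (v + t *: w) = vecb v + t *: vecb w &
      vecc (v + t *: w) = vecc v + t *: vecc w].
Proof. by rewrite /vecA /vecN /vecb /vecc !(linearD, linearZ). Qed.

Lemma loc_lipschitz_vec i j :
  [/\ loc_lipschitz (fun v => vecA v i j),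
      loc_lipschitz (fun v => vecN v i j),
      (forall k, loc_lipschitz (fun v => vecb v i k)) &
      (forall k, loc_lipschitz (fun v => vecc v k j))].
Proof.
have eq_coord (f : V -> R) h : (forall v, f v = v ord0 h) -> loc_lipschitz f.
  by move=> /funext ->; exact: loc_lipschitz_coord.
by split=> [||k|k]; apply: eq_coord => v;
  rewrite /vecA /vecN /vecb /vecc !mxE ?ord1.
Qed.

Definition vec_comm v := vecA v *m vecN v - vecN v *m vecA v.

Lemma loc_lipschitz_comm i j : loc_lipschitz (fun v => vec_comm v i j).
Proof.
have lA a b : loc_lipschitz (fun v => vecA v a b).
  by case: (loc_lipschitz_vec a b).
have lN a b : loc_lipschitz (fun v => vecN v a b).
  by case: (loc_lipschitz_vec a b).
rewrite /vec_comm; under eq_fun do rewrite mxE [in X in _ + X]mxE.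
by apply: loc_lipschitzD; [|apply: loc_lipschitzN]; apply: loc_lipschitz_mulmx.
Qed.

(** Two distinct indices i0 and i1 are available. The slope of c (AN - NA) b
    along c_i0 is the entry i0 of (AN - NA) b; its slope along b_i1 is the
    entry (i0, i1) of AN - NA; the slope of that along A_(i0, i0) is
    N_(i0, i1), to which NA contributes nothing because i0 <> i1; and the
    slope of N_(i0, i1) along itself is 1. *)
Lemma generic_commutator : (2 <= n)%N ->
  generic_systems [set sigma : bilinear_system R n |
    (sysc sigma *m (sysA sigma *m sysN sigma - sysN sigma *m sysA sigma)
      *m sysb sigma) ord0 ord0 != 0].
Proof.
move=> n2; rewrite /generic_systems.
have -> : (@system_vec R n @` [set sigma |
    (sysc sigma *m (sysA sigma *m sysN sigma - sysN sigma *m sysA sigma)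
      *m sysb sigma) ord0 ord0 != 0]) =
  [set v | (vecc v *m vec_comm v *m vecb v) ord0 ord0 != 0].
  apply/seteqP; split => [_ [s /= hs <-]|v /= hv].
    by rewrite /vec_comm; case: (vec_systemK s) => -> -> -> ->.
  by exists (BilinearSystem (vecA v) (vecN v) (vecb v) (vecc v)) => //=;
    rewrite ?system_vecK.
have lb i k : loc_lipschitz (fun v => vecb v i k).
  by case: (loc_lipschitz_vec i i).
have lc k j : loc_lipschitz (fun v => vecc v k j).
  by case: (loc_lipschitz_vec j j).
pose i0 : 'I_n := Ordinal (ltnW n2); pose i1 : 'I_n := Ordinal n2.
apply: (@generic_neq0_of_slope _ _ (rshift _ (rshift _ i0)) _
    (fun v => (vec_comm v *m vecb v) i0 ord0)).
- by apply: loc_lipschitz_mulmx => // i j; apply: loc_lipschitz_mulmx => //;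
    exact: loc_lipschitz_comm.
- move=> v t; rewrite /vec_comm.
  set e := delta_mx _ _; have [-> -> -> ->] := vecP v e t.
  have -> : vecA e = 0 by rewrite /vecA !submx_deltaE linear0 linear0.
  have -> : vecN e = 0 by rewrite /vecN !submx_deltaE linear0 linear0.
  have -> : vecb e = 0 by rewrite /vecb !submx_deltaE linear0.
  have -> : vecc e = delta_mx ord0 i0 by rewrite /vecc !submx_deltaE.
  rewrite !scaler0 !addr0; move: (_ - _) => X.
  rewrite -mulmxA mulmxDl mulmxA -scalemxAl -rowE.
  by rewrite mxE; congr (_ + _); rewrite 2!mxE.
apply: (@generic_neq0_of_slope _ _ (rshift _ (lshift _ i1)) _
    (fun v => vec_comm v i0 i1)).
- by apply: loc_lipschitz_mulmx => //; exact: loc_lipschitz_comm.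
- move=> v t; rewrite /vec_comm.
  set e := delta_mx _ _; have [-> -> -> _] := vecP v e t.
  have -> : vecA e = 0 by rewrite /vecA !submx_deltaE linear0 linear0.
  have -> : vecN e = 0 by rewrite /vecN !submx_deltaE linear0 linear0.
  have -> : vecb e = delta_mx i1 ord0 by rewrite /vecb !submx_deltaE trmx_delta.
  rewrite !scaler0 !addr0; move: (_ - _) => X.
  rewrite mulmxDr -scalemxAr -colE.
  by rewrite mxE; congr (_ + _); rewrite 2!mxE.
apply: (@generic_neq0_of_slope _ _ (lshift _ (lshift _ (mxvec_index i0 i0))) _
    (fun v => vecN v i0 i1)).
- exact: loc_lipschitz_comm.
- move=> v t; rewrite /vec_comm.
  set e := delta_mx _ _; have [-> -> _ _] := vecP v e t.
  have -> : vecA e = delta_mx i0 i0 by rewrite /vecA !submx_deltaE vec_mx_delta.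
  have -> : vecN e = 0 by rewrite /vecN !submx_deltaE linear0.
  rewrite !scaler0 !addr0 mulmxDl mulmxDr opprD addrACA mxE; congr (_ + _).
  rewrite -scalemxAl -scalemxAr -scalerBr mxE; congr (_ * _).
  have -> : (vecN v *m delta_mx i0 i0) =
      \matrix_(i, j) (vecN v i i0 * (j == i0)%:R).
    apply/matrixP => i j; rewrite [LHS]mxE (bigD1 i0)//= big1 => [|k ki0].
      by rewrite [delta_mx _ _ _ _]mxE [RHS]mxE eqxx addr0.
    by rewrite [delta_mx _ _ _ _]mxE (negbTE ki0) mulr0.
  rewrite mxE [X in _ + X]mxE [X in - X]mxE mulr0 subr0.
  rewrite mxE (bigD1 i0)//= big1 => [|k ki0]; last first.
    by rewrite [delta_mx _ _ _ _]mxE (negbTE ki0) andbF mul0r.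
  by rewrite [delta_mx _ _ _ _]mxE !eqxx mul1r addr0.
apply: (@generic_neq0_of_slope _ _ (lshift _ (rshift _ (mxvec_index i0 i1))) _
    (fun v => 1)).
- by case: (loc_lipschitz_vec i0 i1).
- move=> v t; set e := delta_mx _ _; have [_ -> _ _] := vecP v e t.
  have -> : vecN e = delta_mx i0 i1 by rewrite /vecN !submx_deltaE vec_mx_delta.
  by rewrite !mxE !eqxx.
exact/generic_neq0_cst/oner_neq0.
Qed.

End commutator_form.

(** * The matrix exponential *)

Section matrix_exponential.
Context {R : realType}.

Lemma is_cvg_pseries_fact (a : R^nat) (B C K : R) :
  0 <= B -> 0 <= C -> (forall k, `|a k| <= B * C ^+ k) ->
  cvgn (pseries (fun k => a k / k`!%:R) K).
Proof.
move=> B0 C0 aBC; apply: normed_cvg.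
apply: (@series_le_cvg _ _ (fun k => B * exp_coeff (C * `|K|) k)).
- by move=> k; exact: normr_ge0.
- by move=> k; rewrite mulr_ge0// exp_coeff_ge0// mulr_ge0.
- move=> k /=; rewrite /exp_coeff/= exprMn !normrM normrX.
  rewrite (ger0_norm (_ : 0 <= k`!%:R^-1)) ?invr_ge0//.
  rewrite [leLHS]mulrAC mulrA; apply: ler_wpM2r.
    by rewrite invr_ge0.
  by rewrite mulrA ler_wpM2r ?exprn_ge0.
- exact/is_cvg_seriesZ/is_cvg_series_exp_coeff.
Qed.

Lemma pseries_diffs_fact (a : R^nat) :
  pseries_diffs (fun k => a k / k`!%:R) = (fun k => a k.+1 / k`!%:R).
Proof.
apply/funext => k; rewrite /pseries_diffs factS natrM; set m := k.+1%:R.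
have m0 : m != 0 :> R by rewrite pnatr_eq0.
have : k`!%:R != 0 :> R by rewrite pnatr_eq0 -lt0n fact_gt0.
by move: m m0 (k`!%:R) => m m0 f f0; field; rewrite m0 f0.
Qed.

Lemma is_derive_pseries_fact (a : R^nat) (B C t : R) :
  0 <= B -> 0 <= C -> (forall k, `|a k| <= B * C ^+ k) ->
  is_derive t 1 (fun x => limn (pseries (fun k => a k / k`!%:R) x))
    (limn (pseries (fun k => a k.+1 / k`!%:R) t)).
Proof.
move=> B0 C0 aBC; rewrite -pseries_diffs_fact.
have cvg_shift j K : cvgn (pseries (fun k => a (k + j)%N / k`!%:R) K).
  apply: (@is_cvg_pseries_fact _ (B * C ^+ j) C) => //.
    by rewrite mulr_ge0// exprn_ge0.
  by move=> k; rewrite (le_trans (aBC _))// addnC exprD mulrA.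
have K0 : `|t| < `| `|t| + 1|.
  by rewrite [ltRHS]ger0_norm ?addr_ge0// ltrDl.
apply: (pseries_snd_diffs _ _ _ K0); rewrite ?pseries_diffs_fact.
- by have := cvg_shift 0%N (`|t| + 1); under eq_fun do rewrite addn0.
- by have := cvg_shift 1%N (`|t| + 1); under eq_fun do rewrite addn1.
- by have := cvg_shift 2%N (`|t| + 1); under eq_fun do rewrite addn2.
Qed.

Context {n : nat}.
Implicit Types (M : 'M[R]_n).

Lemma expr_mx_le M k i j :
  `|(M ^+ k) i j| <= (\sum_a \sum_b `|M a b|) ^+ k.
Proof.
set C := \sum_a _; have C0 : 0 <= C by apply: sumr_ge0 => a _; exact: sumr_ge0.
elim: k i j => [|k IH] i j.
  by rewrite !expr0 mxE; case: (i == j); rewrite ?normr1 ?normr0.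
rewrite [M ^+ _]exprS mxE (le_trans (ler_norm_sum _ _ _))// exprS.
apply: (@le_trans _ _ (\sum_b `|M i b| * C ^+ k)).
  by apply: ler_sum => b _; rewrite normrM ler_wpM2l.
rewrite -mulr_suml ler_wpM2r ?exprn_ge0//.
by rewrite /C [leRHS](bigD1 i)//= lerDl sumr_ge0// => a _; exact: sumr_ge0.
Qed.

Definition expmx M (t : R) : 'M[R]_n :=
  \matrix_(i, j) limn (pseries (fun k => (M ^+ k) i j / k`!%:R) t).

Lemma expmx0 M : expmx M 0 = 1%:M.
Proof.
apply/matrixP => i j; rewrite mxE.
have -> : 1%:M i j = (M ^+ 0) i j by [].
apply: cvg_lim => //.
rewrite -cvg_shiftS /= (_ : (fun _ => _) = cst ((M ^+ 0) i j)).
  exact: cvg_cst.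
apply/funext => k; rewrite /pseries /series/= big_nat_recl//= big1 ?addr0.
  by rewrite expr0 mulr1 fact0 divr1.
by move=> m _; rewrite expr0n mulr0.
Qed.

Lemma is_cvg_expmx M t i j :
  cvgn (pseries (fun k => (M ^+ k) i j / k`!%:R) t).
Proof.
apply: (@is_cvg_pseries_fact _ 1 (\sum_a \sum_b `|M a b|)) => //.
  by apply: sumr_ge0 => a _; exact: sumr_ge0.
by move=> k; rewrite mul1r expr_mx_le.
Qed.

Lemma pseries_sum_lim (F : 'I_n -> R^nat) (w : 'I_n -> R) t :
  (forall h, cvgn (pseries (F h) t)) ->
  limn (pseries (fun k => \sum_h w h * F h k) t) =
  \sum_h w h * limn (pseries (F h) t).
Proof.
move=> cF; apply: cvg_lim => //.
have -> : pseries (fun k => \sum_h w h * F h k) t =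
    (fun m => \sum_h w h * pseries (F h) t m).
  apply/funext => m; rewrite /pseries /series/=.
  under [RHS]eq_bigr do rewrite mulr_sumr.
  rewrite [RHS]exchange_big/=; apply: eq_bigr => k _.
  by rewrite mulr_suml; apply: eq_bigr => h _; rewrite mulrA.
apply: cvg_big => [|h _]; first exact: add_continuous.
apply: cvgM; [exact: cvg_cst|exact: cF].
Qed.

Lemma expmx_comm M t : expmx M t *m M = M *m expmx M t.
Proof.
apply/matrixP => i j; rewrite !mxE.
under eq_bigr do rewrite mxE mulrC.
rewrite -pseries_sum_lim; last by move=> h; exact: is_cvg_expmx.
under [RHS]eq_bigr do rewrite mxE.
rewrite -pseries_sum_lim; last by move=> h; exact: is_cvg_expmx.
congr (limn (pseries _ _)); apply/funext => k.
have /matrixP/(_ i j) : M ^+ k *m M = M *m M ^+ k.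
  by rewrite !mulmxE -exprS -exprSr.
rewrite !mxE => /(congr1 (fun x => x / k`!%:R)).
rewrite !mulr_suml => E; under eq_bigr do rewrite mulrA [X in X / _]mulrC.
by rewrite E; apply: eq_bigr => h _; rewrite mulrA.
Qed.

Lemma is_derive_expmx M (t : R) i j :
  is_derive t 1 (fun s => expmx M s i j) ((M *m expmx M t) i j).
Proof.
rewrite (_ : (fun s => _) =
  fun s => limn (pseries (fun k => (M ^+ k) i j / k`!%:R) s)); last first.
  by apply/funext => s; rewrite mxE.
have -> : (M *m expmx M t) i j =
    limn (pseries (fun k => (M ^+ k.+1) i j / k`!%:R) t).
  rewrite mxE; under eq_bigr do rewrite mxE.
  rewrite -pseries_sum_lim; last by move=> h; exact: is_cvg_expmx.
  congr (limn (pseries _ _)); apply/funext => k /=.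
  by rewrite exprS mxE mulr_suml; apply: eq_bigr => h _; rewrite mulrA.
apply: (@is_derive_pseries_fact _ 1 (\sum_a \sum_b `|M a b|)) => //.
  by apply: sumr_ge0 => a _; exact: sumr_ge0.
by move=> k; rewrite mul1r expr_mx_le.
Qed.

End matrix_exponential.

(** * Linear differential equations with constant coefficients *)

Section linear_ode.
Context {R : realType}.

Lemma is_derive_mulmx m n p (F dF : R -> 'M[R]_(m, n))
    (G dG : R -> 'M[R]_(n, p)) (t : R) :
  (forall i j, is_derive t 1 (fun s => F s i j) (dF t i j)) ->
  (forall i j, is_derive t 1 (fun s => G s i j) (dG t i j)) ->
  forall i j, is_derive t 1 (fun s => (F s *m G s) i j)
    ((dF t *m G t + F t *m dG t) i j).
Proof.
move=> HF HG i j.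
have -> : (fun s => (F s *m G s) i j) =
    \sum_(h < n) ((fun s => F s i h) * (fun s => G s h j)).
  by apply/funext => s; rewrite mxE fct_sumE.
have D h : is_derive t 1 ((fun s => F s i h) * (fun s => G s h j) : R -> R)
    (F t i h * dG t h j + G t h j * dF t i h).
  exact: is_deriveM.
apply: (is_derive_eq (is_derive_sum D)).
rewrite !mxE -big_split/=; apply: eq_bigr => h _.
by rewrite addrC; congr (_ + _); rewrite mulrC.
Qed.

Lemma is_derive1_continuous (f : R -> R) (df : R -> R) :
  (forall t : R, is_derive t 1 f (df t)) -> continuous f.
Proof.
move=> Hf t; apply/differentiable_continuous/derivable1_diffP.
by case: (Hf t).
Qed.

(** The function s |-> e^((T - s)M) x(s) has derivative zero, since M commutes
    with its exponential; compare its values at 0 and T. *)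
Lemma linear_ode_unique n (M : 'M[R]_n) (x : R -> 'cV[R]_n) (T : R) :
  0 <= T ->
  (forall i, {within `[0, T], continuous (fun s => x s i ord0)}) ->
  (forall (t : R) i, t \in `]0, T[ ->
    is_derive t 1 (fun s => x s i ord0) ((M *m x t) i ord0)) ->
  x T = expmx M T *m x 0.
Proof.
move=> T0 cx dx; apply/colP => i.
pose w s := (expmx M (T - s) *m x s) i ord0.
have dE (t : R) a b : is_derive t 1 (fun s : R => expmx M (T - s) a b)
    ((- (M *m expmx M (T - t))) a b).
  have := @is_derive1_comp _ (fun s => expmx M s a b) (fun s : R => T - s) t
    ((M *m expmx M (T - t)) a b) (-1) (is_derive_expmx _ _ _ _) _.
  rewrite mulrN1 => H; rewrite [X in is_derive _ _ _ X]mxE; apply: H.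
  have D : is_derive t 1 (cst T - id : R -> R) (0 - 1) by exact: is_deriveB.
  by rewrite sub0r in D.
have [||c _] := @MVT_segment _ w (fun=> 0) _ _ T0.
- move=> t tT.
  have dx' a b : is_derive t 1 (fun s => x s a b) ((M *m x t) a b).
    by rewrite ord1; exact: dx.
  have := is_derive_mulmx (dF := fun t => - (M *m expmx M (T - t)))
    (dG := fun t => M *m x t) (dE t) dx' i ord0.
  by rewrite mulmxA expmx_comm mulNmx addNr mxE.
- have -> : w = (fun s => \sum_h (expmx M (T - s) i h * x s h ord0)).
    by apply/funext => s; rewrite /w mxE.
  move=> t; apply: cvg_big => [|h _]; first exact: add_continuous.
  apply: cvgM; last exact: cx.
  apply: (@continuous_subspaceT _ _ _ (fun s => expmx M (T - s) i h)).
  exact: (is_derive1_continuous (fun t => dE t i h)).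
- rewrite mul0r /w subrr subr0 expmx0 mul1mx.
  by move=> /eqP; rewrite subr_eq0 => /eqP ->.
Qed.

End linear_ode.

(** * Integrals against the completed Lebesgue measure *)

Section completed_integral.
Context {R : realType}.
Notation mu := (@lebesgue_measure R).
Notation cmu := (@completed_lebesgue_measure R).

Lemma measurable_fun_completed :
  measurable_fun [set: lebesgueType R]
    (id : lebesgueType R -> measurableTypeR R).
Proof.
move=> _ A mA; rewrite setTI.
apply: sub_caratheodory; exact: mA.
Qed.

(** The Lebesgue measure is the image of its completion under the identity map
    from the Lebesgue to the Borel sigma-algebra, so the integral of a Borel
    function does not depend on the completion. *)
Lemma ge0_integral_completed (g : R -> \bar R) :
  measurable_fun [set: R] g -> (forall x, 0 <= g x)%E ->
  (\int[cmu]_x g x = \int[mu]_x g x)%E.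
Proof.
move=> mg g0.
have := @ge0_integral_pushforward _ _ (lebesgueType R) (measurableTypeR R) R
  id measurable_fun_completed cmu setT g measurableT mg (fun x _ => g0 x).
by rewrite preimage_setT => <-.
Qed.

Lemma integral_completed (D : set R) (g : R -> \bar R) :
  measurable D ->
  measurable_fun D g ->
  (\int[cmu]_(x in D) g x = \int[mu]_(x in D) g x)%E.
Proof.
move=> mD mg; rewrite integral_mkcond [RHS]integral_mkcond.
have {}mg : measurable_fun [set: R] (g \_ D).
  by apply/(measurable_restrictT _ mD).
rewrite integralE [RHS]integralE; congr (_ - _)%E.
  by apply: ge0_integral_completed => //; exact: measurable_funepos.
by apply: ge0_integral_completed => //; exact: measurable_funeneg.
Qed.

Lemma Rintegral_completed (D : set R) (f : R -> R) :
  measurable D ->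
  measurable_fun D f ->
  \int[cmu]_(x in D) f x = \int[mu]_(x in D) f x.
Proof.
move=> mD mf; rewrite /Rintegral integral_completed//.
exact/measurable_EFinP.
Qed.

End completed_integral.

(** * Trajectories for constant and for switched inputs *)

Section trajectories.
Context {R : realType}.
Notation mu := (@lebesgue_measure R).
Notation cmu := (@completed_lebesgue_measure R).

Lemma integral_is_derive (W w : R -> R) (a b : R) : a <= b ->
  (forall t : R, is_derive t 1 W (w t)) -> continuous w ->
  (\int[mu]_(t in `[a, b]) (w t)%:E = (W b - W a)%:E)%E.
Proof.
rewrite le_eqVlt => /predU1P[->|ab] dW cw.
  by rewrite set_itv1 integral_set1 subrr.
have cW := is_derive1_continuous dW.
rewrite (@continuous_FTC2 _ w W)//.
- exact: continuous_subspaceT.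
- split.
  + by move=> t _; case: (dW t).
  + exact/cvg_at_right_filter/cW.
  + exact/cvg_at_left_filter/cW.
- by move=> t _; rewrite derive1E; case: (dW t).
Qed.

Lemma Rintegral_glue (g W1 w1 W2 w2 : R -> R) (a s b : R) : a <= s -> s <= b ->
  (forall t : R, is_derive t 1 W1 (w1 t)) -> continuous w1 ->
  (forall t : R, is_derive t 1 W2 (w2 t)) -> continuous w2 ->
  (forall t, a <= t <= s -> g t = w1 t) ->
  (forall t, s < t <= b -> g t = w2 t) ->
  \int[cmu]_(t in `[a, b]) g t = (W1 s - W1 a) + (W2 b - W2 s).
Proof.
move=> as_ sb dW1 cw1 dW2 cw2 gw1 gw2.
have abE : `[a, b]%classic = `[a, s]%classic `|` `]s, b]%classic.
  by rewrite -itv_bndbnd_setU// bnd_simp.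
have mw w D : continuous w -> measurable D -> measurable_fun D (w : R -> R).
  by move=> cw mD; apply: measurable_funTS; exact: continuous_measurable_fun.
have mg1 : measurable_fun `[a, s] g.
  apply: (eq_measurable_fun w1).
    by move=> t /[!inE]/=; rewrite in_itv/= => /gw1 ->.
  exact: mw.
have mg2 : measurable_fun `]s, b] g.
  apply: (eq_measurable_fun w2).
    by move=> t /[!inE]/=; rewrite in_itv/= => /gw2 ->.
  exact: mw.
have mg : measurable_fun (`[a, s] `|` `]s, b]) g by exact/measurable_funU.
rewrite abE Rintegral_completed//; last exact: measurableU.
rewrite /Rintegral integral_setU_EFin//; last first.
  apply/disj_setPS => t [] /=; rewrite !in_itv/= => /andP[_ ts] /andP[st _].
  by have := lt_le_trans st ts; rewrite ltxx.
have -> : (\int[mu]_(t in `[a, s]) (g t)%:E = (W1 s - W1 a)%:E)%E.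
  rewrite -(integral_is_derive as_ dW1)//; apply: eq_integral => t.
  by rewrite inE/= in_itv/= => /gw1 ->.
have -> : (\int[mu]_(t in `]s, b]) (g t)%:E = (W2 b - W2 s)%:E)%E.
  rewrite -(integral_is_derive sb dW2)// -integral_itv_obnd_cbnd; last first.
    by apply/measurable_EFinP; apply: mw.
  by apply: eq_integral => t; rewrite inE/= in_itv/= => /gw2 ->.
by [].
Qed.

Context {n : nat}.
Implicit Types (M : 'M[R]_n) (b : 'cV[R]_n) (sigma : bilinear_system R n).

Lemma continuous_cV (x : R -> 'cV[R]_n) :
  (forall i, continuous (fun t => x t i ord0)) -> continuous x.
Proof.
move=> cx t.
have -> : x = (fun t => \sum_i x t i ord0 *: (delta_mx i ord0 : 'cV[R]_n)).
  apply/funext => s; rewrite [LHS]matrix_sum_delta; apply: eq_bigr => i _.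
  by rewrite big_ord1.
apply: cvg_big => [|i _]; first exact: add_continuous.
by apply: cvgZr_tmp; exact: cx.
Qed.

Lemma is_derive_expmx_mul M b (t : R) i :
  is_derive t 1 (fun s => (expmx M s *m b) i ord0)
    ((M *m (expmx M t *m b)) i ord0).
Proof.
have db i' j : is_derive t 1 (fun=> b i' j : R) ((0 : 'cV[R]_n) i' j).
  by rewrite mxE; exact: is_derive_cst.
have := is_derive_mulmx (F := expmx M) (dF := fun t => M *m expmx M t)
  (G := fun=> b) (dG := fun=> 0) (is_derive_expmx M t) db i ord0.
by rewrite mulmx0 addr0 mulmxA.
Qed.

Lemma continuous_expmx_mul M b i :
  continuous (fun s => (expmx M s *m b) i ord0).
Proof.
exact: (is_derive1_continuous (fun t => is_derive_expmx_mul M b t i)).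
Qed.

(** By the integral equation and the fundamental theorem of calculus, a
    trajectory solves the differential equation in the classical sense on the
    open interval, where uniqueness applies. *)
Lemma constant_input_trajectory sigma (u : input R) (beta : R)
    (x : R -> 'cV[R]_n) :
  (forall t, t \in `[0, duration u] -> signal u t = beta) ->
  is_trajectory sigma u x -> forall t, t \in `[0, duration u] ->
  x t = expmx (sysA sigma + beta *: sysN sigma) t *m sysb sigma.
Proof.
move=> ub [cx xE] t tT; set M := sysA sigma + _.
have [t0 tu] : 0 <= t /\ t <= duration u by move: tT; rewrite in_itv/= => /andP.
pose f i s := (M *m x s) i ord0.
have cxi i : {within `[0, t], continuous (fun s => x s i ord0)}.
  have : {within `[0, t], continuous x}.
    apply: continuous_subspaceW cx => s /=; rewrite !in_itv/= => /andP[-> st].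
    exact: le_trans st tu.
  move=> cx' s.
  exact: (cvg_comp _ _ (cx' s) (@coord_continuous _ _ _ i ord0 (x s))).
have cf i : {within `[0, t], continuous (f i)}.
  have -> : f i = (fun s => \sum_h M i h * x s h ord0).
    by apply/funext => s; rewrite /f mxE.
  move=> s; apply: cvg_big => [|h _]; first exact: add_continuous.
  by apply: cvgM; [exact: cvg_cst|exact: cxi].
have intf i : mu.-integrable `[0, t] (EFin \o f i).
  by apply: continuous_compact_integrable => //; exact: segment_compact.
have xF i s : 0 <= s <= t ->
    x s i ord0 = sysb sigma i ord0 + \int[mu]_(r in `[0, s]) f i r.
  move=> /andP[s0 st]; rewrite xE; last by rewrite in_itv/= s0 (le_trans st tu).
  have mf : measurable_fun `[0, s] (f i).
    apply: (@measurable_funS _ _ _ _ `[0, t]%classic) => //.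
      by apply: subset_itvl; rewrite bnd_simp.
    by have /integrableP[/measurable_EFinP] := intf i.
  rewrite -(Rintegral_completed _ mf)//.
  congr (_ + _); apply: eq_Rintegral => r /[!inE]/=.
  rewrite in_itv/= => /andP[r0 rs].
  by rewrite ub// in_itv/= r0 (le_trans rs)// (le_trans st).
have x0 : x 0 = sysb sigma.
  apply/colP => i; rewrite xF ?lexx//.
  by rewrite set_itv1 Rintegral_set1 addr0.
rewrite -x0; apply: linear_ode_unique => // s i.
rewrite in_itv/= => /andP[s0 st].
have cfs : {for s, continuous (f i)}.
  move: (cf i); rewrite continuous_within_itvP; last exact: lt_trans st.
  by case=> + _ _; apply; rewrite in_itv/= s0.
have [dF F'] := continuous_FTC1_closed st (intf i) s0 cfs.
have D := derivableP dF; rewrite -derive1E F' in D.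
have bD := is_deriveD (is_derive_cst (sysb sigma i ord0) s 1) D.
rewrite add0r in bD; apply: (near_eq_is_derive _ bD).
near=> r; rewrite xF//; apply/andP; split; near: r.
  by apply: filterS (lt_nbhsr s0) => r /ltW.
by apply: filterS (lt_nbhsl st) => r /ltW.
Unshelve. all: by end_near. Qed.

Lemma switch_measurable (T s : R) :
  measurable_fun (`[0, T]%classic : set (lebesgueType R))
    (\1_(`]s, +oo[) : lebesgueType R -> R).
Proof.
apply: measurable_funTS.
apply: (@measurableT_comp _ _ _ _ _ _
  (\1_(`]s, +oo[) : measurableTypeR R -> R)).
  exact: measurable_indic.
exact: measurable_fun_completed.
Qed.

Lemma switch_bounded (T s : R) : exists M : R,
  {ae cmu, forall t : R, t \in `[0, T] -> `|\1_(`]s, +oo[) t| <= M}.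
Proof.
exists 1; apply: aeW => t _; rewrite indicE.
by case: (_ \in _); rewrite ?normr1 ?normr0.
Qed.

(** The input that is 0 on [0, s] and 1 on ]s, s + r]. *)
Definition switch_input (s r : R) (s0 : 0 <= s) (r0 : 0 <= r) : input R :=
  Input (addr_ge0 s0 r0) (@switch_measurable (s + r) s)
    (@switch_bounded (s + r) s).

Lemma switch_output sigma (s r : R) (s0 : 0 <= s) (r0 : 0 <= r) :
  exists2 y, is_output sigma (switch_input s0 r0) y &
    y (s + r) = (sysc sigma *m (expmx (sysA sigma + sysN sigma) r *m
      (expmx (sysA sigma) s *m sysb sigma))) ord0 ord0.
Proof.
set Q := sysA sigma + sysN sigma; set P := sysA sigma; set b := sysb sigma.
pose X t := expmx P t *m b; pose Y t := expmx Q t *m X s.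
have Y0 : Y 0 = X s by rewrite /Y expmx0 mul1mx.
(* X up to time s and Y afterwards, written so that continuity is visible *)
pose x t : 'cV[R]_n := X (Num.min t s) + Y (Num.max (t - s) 0) - X s.
have xX t : t <= s -> x t = X t.
  move=> ts; rewrite /x; move/min_idPl: (ts) => ->.
  by have /max_idPr -> : t - s <= 0 by [rewrite subr_le0]; rewrite Y0 addrK.
have xY t : s <= t -> x t = Y (t - s).
  move=> st; rewrite /x; move/min_idPr: (st) => ->.
  have /max_idPl -> : 0 <= t - s by rewrite subr_ge0.
  by rewrite addrAC subrr add0r.
exists (fun t => (sysc sigma *m x t) ord0 ord0); last first.
  by rewrite xY ?lerDl// addrAC subrr add0r.
exists x => //; split.
  apply: continuous_subspaceT; apply: continuous_cV => i.
  have -> : (fun t => x t i ord0) = (fun t =>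
      X (Num.min t s) i ord0 + Y (Num.max (t - s) 0) i ord0 - X s i ord0).
    by apply/funext => t; rewrite !mxE.
  move=> t; apply: cvgB; last exact: cvg_cst.
  apply: cvgD.
    apply: (@continuous_comp _ _ _ (fun t => Num.min t s)
      (fun t => X t i ord0)).
      apply: (@continuous_min _ _ id (cst s)) => //; exact: cvg_cst.
    exact: continuous_expmx_mul.
  apply: (@continuous_comp _ _ _ (fun t => Num.max (t - s) 0)
    (fun t => Y t i ord0)).
    apply: (@continuous_max _ _ (fun t => t - s) (cst 0)); last exact: cvg_cst.
    by apply: cvgB; [exact: cvg_id|exact: cvg_cst].
  exact: continuous_expmx_mul.
have Psig t : t <= s -> sysA sigma + \1_(`]s, +oo[) t *: sysN sigma = P.
  move=> ts; rewrite indicE memNset ?scale0r ?addr0//=.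
  by rewrite in_itv/= andbT ltNge ts.
have Qsig t : s < t -> sysA sigma + \1_(`]s, +oo[) t *: sysN sigma = Q.
  by move=> ts; rewrite indicE mem_set ?scale1r//= in_itv/= ts.
have dX i (t : R) : is_derive t 1 (fun t => X t i ord0) ((P *m X t) i ord0).
  exact: is_derive_expmx_mul.
have cX i : continuous (fun t => (P *m X t) i ord0).
  under eq_fun do rewrite mulmxA -expmx_comm -mulmxA.
  exact: continuous_expmx_mul.
have dY i (t : R) :
    is_derive t 1 (fun t => Y (t - s) i ord0) ((Q *m Y (t - s)) i ord0).
  have D : is_derive t 1 (id - cst s : R -> R) (1 - 0) by exact: is_deriveB.
  rewrite subr0 in D.
  have := @is_derive1_comp _ (fun t => Y t i ord0) _ t _ _
    (is_derive_expmx_mul Q (X s) (t - s) i) D.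
  by rewrite mulr1.
have cQY i : continuous (fun t => (Q *m Y t) i ord0).
  under eq_fun do rewrite mulmxA -expmx_comm -mulmxA.
  exact: continuous_expmx_mul.
have cY i : continuous (fun t => (Q *m Y (t - s)) i ord0).
  move=> t; apply: (@continuous_comp _ _ _ (fun t => t - s)
    (fun t => (Q *m Y t) i ord0)).
    by apply: cvgB; [exact: cvg_id|exact: cvg_cst].
  exact: cQY.
move=> t; rewrite in_itv/= => /andP[t0 tT] i.
have [ts|st] := leP t s.
(* before the switch the second piece ]t, t] is empty *)
- rewrite (@Rintegral_glue _ _ _ _ _ 0 t t t0 (lexx t)
    (dX i) (cX i) (dX i) (cX i)).
  + by rewrite subrr addr0 xX// /X expmx0 mul1mx addrC subrK.
  + by move=> q /andP[_ qt]; rewrite Psig ?xX// (le_trans qt).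
  + by move=> q /andP[/lt_le_trans/[apply]]; rewrite ltxx.
- rewrite (@Rintegral_glue _ _ _ _ _ 0 s t s0 (ltW st)
    (dX i) (cX i) (dY i) (cY i)).
  + by rewrite xY ?(ltW st)// subrr Y0 /X expmx0 mul1mx; ring.
  + by move=> q /andP[_ qt]; rewrite Psig ?xX.
  + by move=> q /andP[sq _]; rewrite Qsig ?xY ?(ltW sq).
Qed.

End trajectories.

(** * The dual system *)

Section dual_system.
Context {R : realType} {n : nat}.
Implicit Types (M : 'M[R]_n) (sigma : bilinear_system R n).

Lemma expmx_tr M t : expmx M^T t = (expmx M t)^T.
Proof.
have expr_tr k : M^T ^+ k = (M ^+ k)^T.
  elim: k => [|k IH]; first by rewrite !expr0 [RHS]trmx1.
  by rewrite exprS IH exprSr -!mulmxE trmx_mul.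
apply/matrixP => i j; rewrite !mxE; congr (limn (pseries _ t)).
by apply/funext => k; rewrite expr_tr mxE.
Qed.

(** Durations are nonnegative, so outputs can only be compared on one side
    of 0; this is enough to compare derivatives at 0. *)
Lemma eq_derive_right (f g : R -> R) (a b : R) :
  is_derive (0 : R) 1 f a -> is_derive (0 : R) 1 g b ->
  (forall t, 0 <= t -> f t = g t) -> a = b.
Proof.
move=> df dg fg; apply/eqP; rewrite -subr_eq0; apply/eqP.
have [] : is_derive (0 : R) 1 (f - g) (a - b) by exact: is_deriveB.
rewrite /derive => cvh lim_h.
move: cvh; rewrite /derivable => /cvg_ex[/= c cvh].
have -> : a - b = c by rewrite -lim_h; apply: cvg_lim.
have /cvg_dnbhs_at_right := cvh => cvr.
suff : (fun h : R =>
    h^-1 *: ((f - g) (h *: 1 + 0) - (f - g) 0)) @ 0^'+ --> (0 : R).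
  by move=> cv0; apply: (cvg_unique _ cvr cv0).
apply: (@cvg_trans _ (cst (0 : R) @ 0^'+)); last exact: cvg_cst.
apply: near_eq_cvg; near=> h.
have h0 : 0 <= h by near: h; exact: nbhs_right_ge.
rewrite !fctE /= scaler1 addr0 !fg// !subrr scaler0.
by [].
Unshelve. all: by end_near. Qed.

Lemma is_derive_row_expmx_mul M (c : 'rV[R]_n) (d : 'cV[R]_n) :
  is_derive (0 : R) 1 (fun t => (c *m (expmx M t *m d)) ord0 ord0)
    ((c *m (M *m d)) ord0 ord0).
Proof.
have dc i j : is_derive (0 : R) 1 (fun=> c i j : R) ((0 : 'rV[R]_n) i j).
  by rewrite mxE; exact: is_derive_cst.
have dd i j : is_derive (0 : R) 1 (fun t => (expmx M t *m d) i j)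
    ((M *m (expmx M 0 *m d)) i j).
  by rewrite ord1; exact: is_derive_expmx_mul.
have := is_derive_mulmx (F := fun=> c) (dF := fun=> 0)
  (G := fun t => expmx M t *m d) (dG := fun t => M *m (expmx M t *m d)) dc dd.
by move=> /(_ ord0 ord0); rewrite mul0mx add0r expmx0 mul1mx.
Qed.

Definition dual_system sigma : bilinear_system R n :=
  BilinearSystem (sysA sigma)^T (sysN sigma)^T (sysc sigma)^T (sysb sigma)^T.

(** A number equals its transpose, and transposition commutes with exp. *)
Lemma dual_io_equivalent_constant sigma :
  io_equivalent_under (@constant_inputs R) sigma (dual_system sigma).
Proof.
move=> u [beta ub] y y' [x xtraj yE] [z ztraj zE] t tT; rewrite yE// zE//=.
rewrite (constant_input_trajectory ub xtraj)//.
rewrite (constant_input_trajectory ub ztraj)//=.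
rewrite -linearZ/= -linearD/= expmx_tr -trmx_mul -trmx_mul [RHS]mxE.
by rewrite mulmxA.
Qed.

(** Equality of the outputs under all switched inputs reads
    c e^(rQ) e^(sP) b = b^T e^(rQ^T) e^(sP^T) c^T, and the right-hand side is
    c e^(sP) e^(rQ) b. Differentiating in r and then in s at 0 extracts
    c QP b = c PQ b, where QP - PQ = NA - AN. *)
Lemma dual_io_equivalent_commute sigma :
  io_equivalent sigma (dual_system sigma) ->
  (sysc sigma *m (sysA sigma *m sysN sigma - sysN sigma *m sysA sigma)
    *m sysb sigma) ord0 ord0 = 0.
Proof.
move=> io; pose P := sysA sigma; pose Q := sysA sigma + sysN sigma.
pose b := sysb sigma; pose c := sysc sigma.
have eq_out s r : 0 <= s -> 0 <= r ->
    (c *m (expmx Q r *m (expmx P s *m b))) ord0 ord0 =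
    (b^T *m (expmx Q^T r *m (expmx P^T s *m c^T))) ord0 ord0.
  move=> s0 r0.
  have [y yout yE] := switch_output sigma s0 r0.
  have [y' yout' yE'] := switch_output (dual_system sigma) s0 r0.
  move: yE yE'; rewrite /= -linearD/= => <- <-.
  apply: (io (switch_input s0 r0)) => //.
  by rewrite in_itv/= lexx addr_ge0.
have eq_dr s : 0 <= s ->
    (c *m (Q *m (expmx P s *m b))) ord0 ord0 =
    (b^T *m (Q^T *m (expmx P^T s *m c^T))) ord0 ord0.
  move=> s0; apply: (eq_derive_right (is_derive_row_expmx_mul Q c _)
    (is_derive_row_expmx_mul Q^T b^T _)) => r r0.
  exact: eq_out.
have : (c *m Q *m (P *m b)) ord0 ord0 = (b^T *m Q^T *m (P^T *m c^T)) ord0 ord0.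
  apply: (eq_derive_right (is_derive_row_expmx_mul P (c *m Q) b)
    (is_derive_row_expmx_mul P^T (b^T *m Q^T) c^T)) => s s0.
  by rewrite -!mulmxA eq_dr.
rewrite -!trmx_mul [RHS]mxE -!mulmxA => E.
have {}E : (c *m (P *m (Q *m b)) - c *m (Q *m (P *m b))) ord0 ord0 = 0.
  by rewrite mxE [X in _ + X]mxE E subrr.
rewrite -[RHS]E; congr (fun_of_matrix _ _ _).
rewrite /P /Q -/b -/c mulmxBl mulmxBr !mulmxDl !mulmxDr -!mulmxA.
by rewrite opprD addrACA subrr add0r.
Qed.

End dual_system.

Theorem corollary3p1 (R : realType) (n : nat) (n_ge2 : (2 <= n)%N) :
  exists G : set (bilinear_system R n),
    generic_systems G /\
    forall sigma : bilinear_system R n, G sigma ->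
      exists sigma' : bilinear_system R n,
        [/\ G sigma',
            io_equivalent_under (@constant_inputs R) sigma sigma' &
            ~ io_equivalent sigma sigma'].
Proof.
exists [set sigma | (sysc sigma *m (sysA sigma *m sysN sigma
  - sysN sigma *m sysA sigma) *m sysb sigma) ord0 ord0 != 0]; split.
  exact: generic_commutator.
move=> sigma /= sG; exists (dual_system sigma); split.
- rewrite /= -!trmx_mul -linearB/= -mulmxA -!trmx_mul mxE.
  by rewrite -opprB mulmxN mulNmx mxE oppr_eq0.
- exact: dual_io_equivalent_constant.
- by move=> /dual_io_equivalent_commute sG0; rewrite sG0 eqxx in sG.
Qed.
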